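(* Let $I\subset\mathbb{R}$ be an interval with polarisation $q$ (a non-vanishing real quadratic differential), let $x:(I,q)\to\mathbb{H}$ be a smooth regular polarised curve with dual curve $x^d$, and let $\mu\in\mathbb{R}$. Then the Darboux transforms of $x$ with parameter $\mu$ are given by the $\mathrm{d}_\mu$-parallel sections: a smooth map $\hat x: I\to\mathbb{H}$ is a Darboux transform of $x$ with spectral parameter $\mu$ if and only if there is a smooth $\varphi: I\to\mathbb{H}^2$ with nowhere vanishing second component such that $$\mathrm{d}_\mu\varphi=0 \quad\text{and}\quad \varphi\,\mathbb{H}=\begin{pmatrix}\hat x\\ 1\end{pmatrix}\mathbb{H}\ \text{ at every point of } I .$$
   Context: $\mathbb{H}$ denotes the quaternions, identified with $\mathbb{R}^4$; $\mathbb{H}^2$ is a right $\mathbb{H}$-vector space (matrices act from the left, scalars from the right). Writing $q=\frac1m\,dt^2$ with a non-vanishing real function $m$ on $I$, the dual curve $x^d: I\to\mathbb{H}$ of a regular curve $x:(I,q)\to\mathbb{H}$ is defined (up to translation) by $dx\,dx^d=q$, i.e. $x'(x^d)'=\frac1m$. A curve $\hat x: I\to\mathbb{H}$ is a Darboux transform of $x$ with spectral parameter (or parameter) $\mu\in\mathbb{R}$ if it satisfies the Riccati equation $d\hat x=\mu(\hat x-x)\,dx^d\,(\hat x-x)$. The family of connections $\mathrm{d}_\lambda$ ($\lambda\in\mathbb{R}$) on the trivial bundle $I\times\mathbb{H}^2$ associated with $x$ is $$\mathrm{d}_\lambda = d+\lambda\eta,\qquad \eta=\begin{pmatrix} x\,dx^d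 & -x\,dx^d\,x\\ dx^d & -dx^d\,x\end{pmatrix}.$$ A section $\varphi$ is $\mathrm{d}_\mu$-parallel if $\mathrm{d}_\mu\varphi=d\varphi+\mu\eta\varphi=0$. A point $y\in\mathbb{H}$ is identified with the line $\begin{pmatrix}y\\1\end{pmatrix}\mathbb{H}\in\mathbb{HP}^1\cong\mathbb{H}\cup\{\infty\}$. *)

(* Defs.v *)
From HB Require Import structures.
From mathcomp Require Import all_boot all_order all_algebra.
From mathcomp Require Import all_classical all_reals all_analysis.
From mathcomp Require Import ring.

Set Implicit Arguments.
Unset Strict Implicit.
Unset Printing Implicit Defensive.
Import Order.TTheory GRing.Theory Num.Theory.
Import numFieldNormedType.Exports.

Local Open Scope classical_set_scope.
Local Open Scope ring_scope.

(* The quaternions a + b i + c j + d k, carried by R^4.  The norm inherited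
   from 'rV[R]_4 is the max norm, not the multiplicative quaternion norm; it
   is only used for its topology. *)
Definition quat (R : realType) : Type := 'rV[R]_4.

HB.instance Definition _ (R : realType) := NormedModule.on (quat R).
HB.instance Definition _ (R : realType) := Complete.on (quat R).

Section Quaternions.
Variable R : realType.
Implicit Types p q r : quat R.

Definition mkquat (a b c d : R) : quat R := \row_(i < 4) [:: a; b; c; d]`_i.

Definition qre q : R := q 0 (inord 0).
Definition qi q : R := q 0 (inord 1).
Definition qj q : R := q 0 (inord 2).
Definition qk q : R := q 0 (inord 3).

Definition onequat : quat R := mkquat 1 0 0 0.

Definition mulquat p q : quat R :=
  mkquat (qre p * qre q - qi p * qi q - qj p * qj q - qk p * qk q)
         (qre p * qi q + qi p * qre q + qj p * qk q - qk p * qj q)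
         (qre p * qj q - qi p * qk q + qj p * qre q + qk p * qi q)
         (qre p * qk q + qi p * qj q - qj p * qi q + qk p * qre q).

Lemma quatP p q :
  [/\ qre p = qre q, qi p = qi q, qj p = qj q & qk p = qk q] -> p = q.
Proof.
move=> [h0 h1 h2 h3]; apply/rowP => -[i lti].
have -> : Ordinal lti = inord i by apply/val_inj; rewrite /= inordK.
by case: i lti => [|[|[|[|i]]]] lti.
Qed.

Lemma mkquatE a b c d :
  (qre (mkquat a b c d) = a) * (qi (mkquat a b c d) = b) *
  (qj (mkquat a b c d) = c) * (qk (mkquat a b c d) = d).
Proof. by rewrite /qre /qi /qj /qk !mxE !inordK. Qed.

Lemma quatDE p q :
  (qre (p + q) = qre p + qre q) * (qi (p + q) = qi p + qi q) *
  (qj (p + q) = qj p + qj q) * (qk (p + q) = qk p + qk q).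
Proof. by rewrite /qre /qi /qj /qk !mxE. Qed.

Lemma quatZE (a : R) q :
  (qre (a *: q) = a * qre q) * (qi (a *: q) = a * qi q) *
  (qj (a *: q) = a * qj q) * (qk (a *: q) = a * qk q).
Proof. by rewrite /qre /qi /qj /qk !mxE. Qed.

Lemma quat0E :
  (qre 0 = 0) * (qi 0 = 0) * (qj 0 = 0) * (qk 0 = 0).
Proof. by rewrite /qre /qi /qj /qk !mxE. Qed.

Lemma mulquatA : associative mulquat.
Proof. by move=> p q r; apply: quatP; rewrite !mkquatE; split; ring. Qed.

Lemma mul1quat : left_id onequat mulquat.
Proof. by move=> p; apply: quatP; rewrite !mkquatE; split; ring. Qed.

Lemma mulquat1 : right_id onequat mulquat.
Proof. by move=> p; apply: quatP; rewrite !mkquatE; split; ring. Qed.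

Lemma mulquatDl : left_distributive mulquat +%R.
Proof.
by move=> p q r; apply: quatP; rewrite !(mkquatE, quatDE); split; ring.
Qed.

Lemma mulquatDr : right_distributive mulquat +%R.
Proof.
by move=> p q r; apply: quatP; rewrite !(mkquatE, quatDE); split; ring.
Qed.

Lemma onequat_neq0 : onequat != 0.
Proof.
apply/eqP => /(congr1 qre); rewrite mkquatE quat0E => /eqP.
by rewrite oner_eq0.
Qed.

HB.instance Definition _ := GRing.Zmodule_isNzRing.Build (quat R)
  mulquatA mul1quat mulquat1 mulquatDl mulquatDr onequat_neq0.

Lemma scalequatAl (a : R) p q : a *: (p * q) = (a *: p) * q.
Proof. by apply: quatP; rewrite !(mkquatE, quatZE); split; ring. Qed.

HB.instance Definition _ :=
  GRing.Lmodule_isLalgebra.Build R (quat R) scalequatAl.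

Lemma scalequatAr (a : R) p q : a *: (p * q) = p * (a *: q).
Proof. by apply: quatP; rewrite !(mkquatE, quatZE); split; ring. Qed.

HB.instance Definition _ :=
  GRing.Lalgebra_isAlgebra.Build R (quat R) scalequatAr.

End Quaternions.

(* Calculus of maps I -> V on an arbitrary (open, closed, half-open) interval.
   Such a map is a total function R -> V of which only the values on I matter;
   at an endpoint belonging to I the derivative is the one-sided one. *)
Section CalculusOn.
Variables (R : realType) (V : normedModType R).
Implicit Types (I : set R) (f : R -> V).

Definition quotient_on I f (t : R) : set_system V :=
  (s - t)^-1 *: (f s - f t) @[s --> within I t^'].

Definition derivable_on I f : Prop := forall t, I t -> cvg (quotient_on I f t).

Definition derive_on I f (t : R) : V := lim (quotient_on I f t).

Definition smooth_on I f : Prop :=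
  forall n, derivable_on I (iter n (derive_on I) f).

End CalculusOn.

Section DarbouxTransforms.
Variable R : realType.
Local Notation H := (quat R).
Implicit Types (I : set R) (m : R -> R) (x xd xhat : R -> H).
Implicit Types (phi : R -> 'cV[H]_2) (lam mu t : R).

(* The quadratic differential q = (1/m) dt^2 on I. *)
Definition polarisation I m : Prop :=
  smooth_on I (m : R -> R^o) /\ forall t, I t -> m t != 0.

Definition regular_curve I x : Prop :=
  smooth_on I x /\ forall t, I t -> derive_on I x t != 0.

Definition dual_curve I m x xd : Prop :=
  derivable_on I xd /\
  forall t, I t -> derive_on I x t * derive_on I xd t = ((m t)^-1)%:A.

Definition darboux_transform I x xd mu xhat : Prop :=
  derivable_on I xhat /\
  forall t, I t ->
    derive_on I xhat t =
      mu *: ((xhat t - x t) * derive_on I xd t * (xhat t - x t)).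

(* Sections of the trivial bundle I x H^2 are maps to 'cV[H]_2; one-forms on I
   are given by their dt-coefficient. *)
Definition smooth_section I phi : Prop :=
  forall i, smooth_on I (fun t => phi t i 0).

Definition derive_section I phi t : 'cV[H]_2 :=
  \col_i derive_on I (fun s => phi s i 0) t.

Definition eta I x xd t : 'M[H]_2 :=
  let y := x t in let dxd := derive_on I xd t in
  \matrix_(i, j)
    if i == 0 then if j == 0 then y * dxd else - (y * dxd * y)
              else if j == 0 then dxd     else - (dxd * y).

Definition connection I x xd lam phi t : 'cV[H]_2 :=
  derive_section I phi t + lam%:A *: (eta I x xd t *m phi t).

Definition parallel I x xd lam phi : Prop :=
  forall t, I t -> connection I x xd lam phi t = 0.

(* v H : scalars act on H^2 from the right. *)
Definition line (v : 'cV[H]_2) : set 'cV[H]_2 :=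
  [set v *m h%:M | h in [set: H]].

Definition affine_pt (y : H) : 'cV[H]_2 :=
  \col_i if i == 0 then y else 1.

End DarbouxTransforms.

(* Main.v *)
Require Import Defs.
From mathcomp Require Import all_boot all_order all_algebra.
From mathcomp Require Import all_classical all_reals all_analysis.
From mathcomp Require Import ring lra.

(** Write a section with nowhere vanishing second component as
    phi = (a, b).  The line condition says a = xhat b, and then, with
    E = mu (x^d)' (xhat - x) b, the section is d_mu-parallel exactly when
    b' = - E and a' = - x E.

    If phi is parallel, differentiating a = xhat b gives
    xhat' b = a' - xhat b' = (xhat - x) E, and cancelling b on the right is
    the Riccati equation.

    Conversely, given a solution xhat of the Riccati equation, the same
    computation shows that (xhat b, b) is parallel as soon as b solves the
    linear equation b' = A b with A = - mu (x^d)' (xhat - x).  The content of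
    the theorem is therefore that this equation has a smooth nowhere vanishing
    solution on all of I, which may be open, closed or half-open and
    unbounded.  The quaternions do not commute, so b is not an exponential of
    a primitive of A and has to be constructed.

    - Existence ([linear_ode]).  A continuous map on I has a primitive on I
      ([quat_primitive_on], from the Lebesgue integral and the fundamental
      theorem of calculus).  Picard iteration from the constant 1 then works
      on I in one go: on a segment of I on which |A q| <= K |q|, successive
      iterates differ by at most 2^-(n+1) exp (2 K |t - t0|).  Measuring
      against this exponential weight makes every integration gain a factor
      1/2, whatever the length of the segment ([weighted_mean_value], a mean
      value inequality).

    - Nonvanishing ([linear_ode_neq0]).  Solving d' = - conj(A) d, the
      conjugate c = conj(d) satisfies c' = - c A, so that (c b)' = 0 and c b
      keeps its initial value 1.

    - Smoothness.  Since x' (x^d)' = 1/m, the map (x^d)' = m^-1 (x')^-1 is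
      smooth ([Cn_derive_dual]), hence so is A, and b' = A b gives b one more
      derivative at each step.

    One-sided derivatives at the endpoints of I are handled by working
    throughout with difference quotients restricted to I. *)

Set Implicit Arguments.
Unset Strict Implicit.
Unset Printing Implicit Defensive.
Import Order.TTheory GRing.Theory Num.Theory.
Import numFieldNormedType.Exports.
Local Open Scope classical_set_scope.
Local Open Scope ring_scope.

(** * Derivatives along a set of reals *)

Section HasDeriv.
Variables (R : realType) (I : set R).

Definition has_deriv (V : normedModType R) (f : R -> V) (t : R) (l : V) :=
  quotient_on I f t --> l.

Lemma has_derivE (V : normedModType R) (f : R -> V) (t : R) (l : V) :
  has_deriv f t l =
  ((fun s => (s - t)^-1 *: (f s - f t)) @ within I t^' --> l).
Proof. by []. Qed.

Definition cont_on (V : normedModType R) (f : R -> V) : Prop :=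
  forall t, I t -> f @ within I (nbhs t) --> f t.

Lemma cvg_within_dnbhs (V : normedModType R) (f : R -> V) (t : R) (l : V) :
  f @ within I (nbhs t) --> l -> f @ within I t^' --> l.
Proof.
apply: cvg_trans; apply: cvg_app => A /=; rewrite /within /=.
exact: nbhs_dnbhs.
Qed.

(** The derivative is defined with punctured neighbourhoods; adding the centre
    back costs nothing because there the map takes its limit value. *)
Lemma dnbhs_within_cvg (V : normedModType R) (f : R -> V) (t : R) :
  f @ within I t^' --> f t -> f @ within I (nbhs t) --> f t.
Proof.
move=> ft A At; have := ft A At.
rewrite /= /within /= !near_simpl /= => h.
rewrite /prop_near1 (dnbhsE t); split=> //.
apply/principal_filterP => _; exact: nbhs_singleton.
Qed.

Lemma has_deriv_cont (V : normedModType R) (f : R -> V) (t : R) (l : V) :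
  has_deriv f t l -> f @ within I (nbhs t) --> f t.
Proof.
rewrite has_derivE => df; apply: dnbhs_within_cvg.
have h : (fun s => (s - t) *: ((s - t)^-1 *: (f s - f t)) + f t) @
    within I t^' --> 0 *: l + f t.
  apply: cvgD; last exact: cvg_cst.
  apply: cvgZ => //; rewrite -(subrr t); apply: cvgB; last exact: cvg_cst.
  by apply: cvg_within_dnbhs; apply: cvg_within_filter.
rewrite scale0r add0r in h; apply: (cvg_trans _ h); apply: near_eq_cvg.
rewrite /= near_withinE; near=> s => _.
rewrite scalerA mulfV ?scale1r ?subrK // subr_eq0.
by near: s; exact: nbhs_dnbhs_neq.
Unshelve. all: by end_near. Qed.

(** The derivative at t only sees the germ of the map at t, relative to I. *)
Lemma has_deriv_near (V : normedModType R) (f g : R -> V) (t : R) (l : V) :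
  I t -> (\forall s \near t, I s -> f s = g s) ->
  has_deriv f t l -> has_deriv g t l.
Proof.
move=> It fg; apply: cvg_trans; apply: near_eq_cvg.
have ft : f t = g t by apply: (nbhs_singleton fg).
apply: nbhs_dnbhs; move: fg; apply: filterS => s fg Is /=.
by rewrite ft fg.
Qed.

Lemma has_deriv_eq (V : normedModType R) (f g : R -> V) (t : R) (l : V) :
  I t -> (forall s, I s -> f s = g s) -> has_deriv f t l -> has_deriv g t l.
Proof. by move=> It fg; apply: has_deriv_near => //; near=> s; exact: fg.
Unshelve. all: by end_near. Qed.

Lemma has_deriv_cst (V : normedModType R) (c : V) (t : R) :
  has_deriv (fun=> c) t 0.
Proof.
rewrite /has_deriv /quotient_on; under eq_fun do rewrite subrr scaler0.
exact: cvg_cst.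
Qed.

Lemma has_derivD (V : normedModType R) (f g : R -> V) (t : R) (a b : V) :
  has_deriv f t a -> has_deriv g t b ->
  has_deriv (fun s => f s + g s) t (a + b).
Proof.
rewrite !has_derivE => df dg; apply: cvg_trans (cvgD df dg); apply: near_eq_cvg.
by near=> s => /=; rewrite !fctE -scalerDr opprD addrACA.
Unshelve. all: by end_near. Qed.

Lemma has_deriv_linear (V W : normedModType R) (L : V -> W)
    (f : R -> V) (t : R) (l : V) :
  linear L -> continuous L -> has_deriv f t l -> has_deriv (L \o f) t (L l).
Proof.
rewrite !has_derivE => Ll Lc df.
apply: cvg_trans (@continuous_cvg _ _ _ _ _ _ L l (Lc l) df).
apply: near_eq_cvg; near=> s => /=.
have LB x y : L (x - y) = L x - L y.
  have /= := Ll (-1) y x; rewrite !scaleN1r [x - y]addrC => ->.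
  by rewrite addrC.
have /= := Ll (s - t)^-1 (f s - f t) 0.
by rewrite addr0 -(subrr 0) !LB subrr addr0 => ->.
Unshelve. all: by end_near. Qed.

(** The Leibniz rule, once for all products at hand: the scalar action of R and
    quaternion multiplication.  It is the usual decomposition
    B(f s, g s) - B(f t, g t) = B(f s - f t, g s) + B(f t, g s - g t); the
    continuity of B is asked along filters, the form in which it is used. *)
Lemma has_deriv_bilinear (U V W : normedModType R) (B : U -> V -> W)
    (f : R -> U) (g : R -> V) (t : R) (a : U) (b : V) :
  (forall v, linear (B^~ v)) -> (forall u, linear (B u)) ->
  (forall (F : set_system R) (u : R -> U) (v : R -> V) (x : U) (y : V),
    Filter F -> u @ F --> x -> v @ F --> y ->
    (fun s => B (u s) (v s)) @ F --> B x y) ->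
  has_deriv f t a -> has_deriv g t b ->
  has_deriv (fun s => B (f s) (g s)) t (B a (g t) + B (f t) b).
Proof.
move=> Bl Br Bc df dg.
have gt := cvg_within_dnbhs (has_deriv_cont dg).
move: df dg; rewrite !has_derivE => df dg.
have FF : Filter (within I t^') by exact: within_filter.
have h : (fun s => B ((s - t)^-1 *: (f s - f t)) (g s) +
    B (f t) ((s - t)^-1 *: (g s - g t))) @ within I t^' -->
    B a (g t) + B (f t) b.
  by apply: cvgD; apply: Bc => //; exact: cvg_cst.
apply: (cvg_trans _ h); apply: near_eq_cvg; near=> s; rewrite /=.
have BlB x y v : B (x - y) v = B x v - B y v.
  have /= := Bl v (-1) y x; rewrite !scaleN1r [x - y]addrC => ->.
  by rewrite addrC.
have BrB x y v : B v (x - y) = B v x - B v y.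
  have /= := Br v (-1) y x; rewrite !scaleN1r [x - y]addrC => ->.
  by rewrite addrC.
have BlZ c x v : B (c *: x) v = c *: B x v.
  by have /= := Bl v c x 0; rewrite addr0 -(subrr x) BlB subrr addr0.
have BrZ c x v : B v (c *: x) = c *: B v x.
  by have /= := Br v c x 0; rewrite addr0 -(subrr x) BrB subrr addr0.
by rewrite BlZ BrZ -scalerDr BlB BrB addrA subrK.
Unshelve. all: by end_near. Qed.

Lemma has_derivZ (V : normedModType R) (f : R -> R^o) (g : R -> V) (t : R)
    (a : R^o) (b : V) :
  has_deriv f t a -> has_deriv g t b ->
  has_deriv (fun s => f s *: g s) t (a *: g t + f t *: b).
Proof.
apply: (@has_deriv_bilinear _ _ _ (fun (u : R^o) (v : V) => u *: v)).
- by move=> v k x y; rewrite scalerDl scalerA.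
- by move=> v k x y; rewrite scalerDr !scalerA [v * k]mulrC.
- by move=> F u v x y FF; apply: cvgZ.
Qed.

Lemma has_derivN (V : normedModType R) (f : R -> V) (t : R) (a : V) :
  has_deriv f t a -> has_deriv (fun s => - f s) t (- a).
Proof.
rewrite !has_derivE => df; apply: cvg_trans (cvgN df); apply: near_eq_cvg.
near=> s => /=; rewrite !fctE -scalerN; congr (_ *: _).
by rewrite opprB opprK addrC.
Unshelve. all: by end_near. Qed.

Lemma has_derivB (V : normedModType R) (f g : R -> V) (t : R) (a b : V) :
  has_deriv f t a -> has_deriv g t b ->
  has_deriv (fun s => f s - g s) t (a - b).
Proof. by move=> df /has_derivN; exact: has_derivD. Qed.

Lemma has_derivV (f : R -> R^o) (t : R) (a : R^o) :
  f t != 0 -> has_deriv f t a ->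
  has_deriv (fun s => (f s)^-1 : R^o) t (- a * (f t)^-1 * (f t)^-1).
Proof.
move=> ft0 df.
have ft := cvg_within_dnbhs (has_deriv_cont df).
move: df; rewrite !has_derivE => df.
have fV : (fun s => (f s)^-1 : R^o) @ within I t^' --> (f t)^-1 by exact: cvgV.
have h : (fun s => - ((s - t)^-1 *: (f s - f t)) * (f s)^-1 * (f t)^-1 : R^o)
    @ within I t^' --> - a * (f t)^-1 * (f t)^-1.
  by apply: cvgM; [apply: cvgM => //; exact: cvgN | exact: cvg_cst].
apply: (cvg_trans _ h); apply: near_eq_cvg.
have nz : \forall s \near within I t^', f s != 0.
  exact: (cvgr_neq0 (f t) ft ft0).
move: nz; apply: filterS => s fs0 /=.
rewrite /GRing.scale /=; move: ((s - t)^-1) => c.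
have -> : (f s)^-1 - (f t)^-1 = - (f s - f t) * (f s)^-1 * (f t)^-1.
  by field; rewrite fs0 ft0.
by rewrite !mulrA mulrN.
Qed.

End HasDeriv.

Section Uniqueness.
Variables (R : realType) (I : set R).
Hypotheses (Iitv : is_interval I) (I0 : I° !=set0).

(** Derivatives relative to I are unique because no point of I is isolated in
    I: a nonempty interior provides a second point p of I, and I contains the
    segment from t to p. *)
Lemma within_dnbhs_proper (t : R) : I t -> ProperFilter (within I t^').
Proof.
move=> It; apply: Build_ProperFilter_ex.
have [p Ip pt] : exists2 p, I p & p != t.
  have [c cI] := I0; have /nbhs_ballP[e /= e0 eI] := cI.
  have [ct|] := eqVneq c t; last by exists c => //; apply/eI/ballxx.
  exists (c + e / 2).
    by apply: eI; rewrite /ball /= opprD addNKr normrN gtr0_norm; lra.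
  by rewrite -ct; apply/eqP; lra.
move=> A; rewrite /within /dnbhs /= => /nbhs_ballP[e /= e0 eA].
have [tp|pt'] := ltP t p.
- pose s := Num.min (t + e / 2) p.
  have ts : t < s by rewrite lt_min tp andbT; lra.
  have se : s <= t + e / 2 by rewrite ge_min lexx.
  exists s; apply: eA.
  + by rewrite /ball /= ltr0_norm; lra.
  + by rewrite gt_eqF.
  + by apply: (Iitv It Ip); rewrite ltW //= ge_min lexx orbT.
- have {}pt : p < t by rewrite lt_neqAle pt.
  pose s := Num.max (t - e / 2) p.
  have ts : s < t by rewrite gt_max pt andbT; lra.
  have se : t - e / 2 <= s by rewrite le_max lexx.
  exists s; apply: eA.
  + by rewrite /ball /= gtr0_norm; lra.
  + by rewrite lt_eqF.
  + by apply: (Iitv Ip It); rewrite (ltW ts) le_max lexx orbT.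
Qed.

Variable (V : normedModType R).
Implicit Types f g : R -> V.

Lemma has_deriv_derive_on f (t : R) (l : V) :
  I t -> has_deriv I f t l -> derive_on I f t = l.
Proof.
move=> It; rewrite has_derivE => df.
have PF := within_dnbhs_proper It.
by apply: cvg_lim => //; exact: norm_hausdorff.
Qed.

Lemma derivable_on_has_deriv f (t : R) :
  derivable_on I f -> I t -> has_deriv I f t (derive_on I f t).
Proof. by move=> df It; exact: df. Qed.

Lemma has_deriv_derivable_on f g :
  (forall t, I t -> has_deriv I f t (g t)) -> derivable_on I f.
Proof. by move=> df t It; apply/cvg_ex; exists (g t); exact: df. Qed.

End Uniqueness.

(** * Topology of the quaternions *)

Section QuatTopology.
Variable R : realType.
Local Notation H := (quat R).

(** Reduces a claim on the coordinates of a row vector to the four named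
    components, on which products are computed. *)
Lemma quat_coord (P : (H -> R) -> Prop) :
  P (@qre R) -> P (@qi R) -> P (@qj R) -> P (@qk R) ->
  forall i : 'I_4, P (fun q => q 0 i).
Proof.
move=> P0 P1 P2 P3 [i lti].
have -> : Ordinal lti = inord i by apply/val_inj; rewrite /= inordK.
by case: i lti => [|[|[|[|i]]]] lti.
Qed.

Lemma quat_coord_norm (q : H) (i : 'I_4) : `|q 0 i| <= `|q|.
Proof.
rewrite [leRHS]/Num.norm /= mx_normrE; apply/bigmax_geP; right => /=.
by exists (0, i).
Qed.

Lemma quat_norm_le (q : H) (e : R) :
  0 <= e -> (forall i, `|q 0 i| <= e) -> `|q| <= e.
Proof.
move=> e0 qe; rewrite [leLHS]/Num.norm /= mx_normrE; apply/bigmax_leP.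
split=> //.
by move=> [j i] _ /=; rewrite ord1; exact: qe.
Qed.

Lemma quat_norm1 : `|1 : H| <= 1.
Proof.
apply: quat_norm_le => // i; move: i.
apply: (quat_coord (P := fun c => `|c (onequat R)| <= 1)).
all: by rewrite /onequat mkquatE ?normr0 ?normr1.
Qed.

(** The norm is the maximum of the coordinates, hence not multiplicative; each
    coordinate of a product is a sum of four products, whence the factor 4. *)
Lemma quat_normM (p q : H) : `|p * q| <= 4 * `|p| * `|q|.
Proof.
have pq i j : `|p 0 i * q 0 j| <= `|p| * `|q|.
  by rewrite normrM ler_pM ?quat_coord_norm.
have tri (a b c d M : R) : `|a| <= M -> `|b| <= M -> `|c| <= M -> `|d| <= M ->
    `|a + b + c + d| <= 4 * M.
  rewrite !ler_norml => /andP[? ?] /andP[? ?] /andP[? ?] /andP[? ?].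
  by apply/andP; split; lra.
apply: quat_norm_le => [|i]; first by rewrite !mulr_ge0.
move: i; apply: (quat_coord (P := fun c => `|c (p * q)| <= _)).
all: rewrite -[p * q]/(mulquat p q) !mkquatE -mulrA.
all: by apply: tri; rewrite ?normrN; apply: pq.
Qed.

Lemma quat_cvg (T : Type) (F : set_system T) (f : T -> H) (l : H) :
  Filter F -> (forall i, f s 0 i @[s --> F] --> (l 0 i : R^o)) -> f @ F --> l.
Proof.
move=> FF fl; apply/cvgrPdist_le => e e0.
have h : \forall s \near F, forall i, `|l 0 i - f s 0 i| <= e.
  by apply: filter_forall => i; move: e e0; apply/cvgrPdist_le; exact: fl.
move: h; apply: filterS => s h; apply: quat_norm_le => [|i]; first exact: ltW.
by rewrite !mxE; exact: h.
Qed.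

Lemma quat_coord_cvg (i : 'I_4) (T : Type) (F : set_system T) (f : T -> H)
    (l : H) :
  Filter F -> f @ F --> l -> f s 0 i @[s --> F] --> (l 0 i : R^o).
Proof.
move=> FF fl.
exact: (@continuous_cvg _ _ _ F FF f (fun M : H => M 0 i : R^o) l
  (@coord_continuous R 1 4 0 i l) fl).
Qed.

Lemma quat_cvgM (T : Type) (F : set_system T) (f g : T -> H) (a b : H) :
  Filter F -> f @ F --> a -> g @ F --> b -> (fun s => f s * g s) @ F --> a * b.
Proof.
move=> FF fa gb; apply: quat_cvg.
have ca i := quat_coord_cvg (i := i) FF fa.
have cb i := quat_coord_cvg (i := i) FF gb.
have cM i j : f s 0 i * g s 0 j @[s --> F] --> (a 0 i * b 0 j : R^o).
  by apply: cvgM; [exact: ca | exact: cb].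
apply: (quat_coord
  (P := fun c => c (f s * g s) @[s --> F] --> (c (a * b) : R^o))).
all: rewrite -[a * b]/(mulquat a b) mkquatE.
all: under eq_fun => s do rewrite -[f s * g s]/(mulquat (f s) (g s)) mkquatE.
all: rewrite /qre /qi /qj /qk.
- by apply: cvgB => //; apply: cvgB => //; exact: cvgB.
- by apply: cvgB => //; apply: cvgD => //; exact: cvgD.
- by apply: cvgD => //; apply: cvgD => //; exact: cvgB.
- by apply: cvgD => //; apply: cvgB => //; exact: cvgD.
Qed.

Lemma has_deriv_quatM (I : set R) (f g : R -> H) (t : R) (a b : H) :
  has_deriv I f t a -> has_deriv I g t b ->
  has_deriv I (fun s => f s * g s) t (a * g t + f t * b).
Proof.
apply: has_deriv_bilinear.
- by move=> v k x y; rewrite mulrDl scalerAl.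
- by move=> v k x y; rewrite mulrDr scalerAr.
- by move=> F u v x y FF; exact: quat_cvgM.
Qed.

Lemma has_deriv_coord (I : set R) (f : R -> H) (t : R) (l : H) :
  has_deriv I f t l <->
  forall i, has_deriv I (fun s => f s 0 i : R^o) t (l 0 i).
Proof.
split=> [df i|df].
  rewrite has_derivE; have := quat_coord_cvg (i := i) _ df.
  by under [in X in X -> _]eq_fun do rewrite !mxE; exact.
rewrite has_derivE; apply: quat_cvg => i.
by under eq_fun do rewrite !mxE; exact: df.
Qed.

End QuatTopology.

(** * Mean value inequalities *)

Section MeanValue.
Variables (R : realType) (I : set R).

Lemma is_derive_has_deriv (f : R -> R^o) (t : R) (l : R^o) :
  is_derive t (1 : R) f l -> has_deriv I f t l.
Proof.
move=> [df dfl]; rewrite has_derivE.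
have {df dfl} : (fun h => h^-1 *: ((f \o shift t) (h *: (1 : R)) - f t)) @ 0^'
    --> l by rewrite -dfl; exact: df.
move=> /cvgrPdist_le fl; apply/cvgrPdist_le => e /fl.
rewrite /dnbhs /within /= => /nbhs_ballP[d /= d0 dP].
apply/nbhs_ballP; exists d => // s ts st Is.
have := dP (s - t); rewrite /ball /= sub0r normrN -normrN opprB => /(_ ts).
by rewrite subr_eq0 => /(_ st); rewrite scaler1 subrK.
Qed.

Lemma has_deriv_is_derive (f : R -> R^o) (t : R) (l : R^o) :
  nbhs t I -> has_deriv I f t l -> is_derive t (1 : R) f l.
Proof.
rewrite has_derivE => tI fl.
suff h : (fun h => h^-1 *: ((f \o shift t) (h *: (1 : R)) - f t)) @ 0^' --> l.
  by split; [apply/cvg_ex; exists l | apply: cvg_lim => //; exact: Rhausdorff].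
move: fl => /cvgrPdist_le fl; apply/cvgrPdist_le => e /fl.
rewrite /dnbhs /within /= => {}fl.
have /nbhs_ballP [d /= d0 dP] := @filterI _ _ (nbhs_filter t) _ _ tI fl.
apply/nbhs_ballP; exists d => // h; rewrite /ball /= sub0r normrN => hd h0.
have [] := dP (t + h); rewrite /ball /=.
  by rewrite opprD addNKr normrN.
move=> It /(_ _ It); rewrite addrC addrK scaler1; apply.
by rewrite -subr_eq0 addrK.
Qed.

Lemma cont_on_itv (V : normedModType R) (f : R -> V) (a b : R) :
  `[a, b] `<=` I -> cont_on I f -> {within `[a, b], continuous f}.
Proof.
move=> abI cf; apply/subspace_continuousP => t /abI It.
apply: cvg_trans (cf t It); apply: cvg_app.
exact: within_subset.
Qed.

(** The mean value theorem for h - f: points strictly between a and b are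
    interior to I, so there the derivative relative to I is an ordinary one. *)
Lemma mean_value_le (f h : R -> R^o) (f' h' : R -> R) (a b : R) :
  a <= b -> `[a, b] `<=` I ->
  (forall s, s \in `[a, b]%R -> has_deriv I f s (f' s)) ->
  (forall s, s \in `[a, b]%R -> has_deriv I h s (h' s)) ->
  (forall s, s \in `[a, b]%R -> f' s <= h' s) ->
  f b - f a <= h b - h a.
Proof.
move=> ab abI df dh fh.
pose g s : R^o := h s - f s.
have dg s : s \in `[a, b]%R -> has_deriv I g s (h' s - f' s).
  by move=> sab; apply: has_derivB; [exact: dh | exact: df].
have [||c cab gE] := @MVT_segment R g (fun s => h' s - f' s) a b ab.
- move=> s sab; apply: has_deriv_is_derive; last first.
    by apply: dg; apply: subset_itv_oo_cc sab.
  apply: filterS abI _; apply: (@filterS _ _ _ `]a, b[).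
    exact: subset_itv_oo_cc.
  by apply: open_nbhs_nbhs; split => //; exact: interval_open.
- apply/subspace_continuousP => s sab.
  apply: cvg_trans (has_deriv_cont (dg s sab)); apply: cvg_app.
  exact: within_subset.
- have : 0 <= g b - g a.
    by rewrite gE mulr_ge0 ?subr_ge0 ?fh.
  by rewrite /g; lra.
Qed.

End MeanValue.

Section QuatMeanValue.
Variables (R : realType) (I : set R).
Local Notation H := (quat R).

(** For the maximum norm the inequality can be checked coordinate by
    coordinate, where it bounds both f and - f by h. *)
Lemma quat_mean_value (f f' : R -> H) (h : R -> R^o) (h' : R -> R) (a b : R) :
  a <= b -> `[a, b] `<=` I ->
  (forall s, s \in `[a, b]%R -> has_deriv I f s (f' s)) ->
  (forall s, s \in `[a, b]%R -> has_deriv I h s (h' s)) ->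
  (forall s, s \in `[a, b]%R -> `|f' s| <= h' s) ->
  `|f b - f a| <= h b - h a.
Proof.
move=> ab abI df dh fh.
have h0 : 0 <= h b - h a.
  have := @mean_value_le R I (fun=> 0) h (fun=> 0) h' a b ab abI.
  rewrite subrr; apply=> // [s _|s sab]; first exact: has_deriv_cst.
  exact: le_trans (fh _ sab).
apply: quat_norm_le => // i; rewrite !mxE ler_norml; apply/andP.
have dfi s : s \in `[a, b]%R ->
    has_deriv I (fun s => f s 0 i : R^o) s (f' s 0 i).
  by move=> /df /has_deriv_coord.
have fhi s : s \in `[a, b]%R -> - h' s <= f' s 0 i <= h' s.
  by move=> sab; rewrite -ler_norml (le_trans (quat_coord_norm _ _))// fh.
split; last first.
  by apply: (mean_value_le ab abI dfi dh) => s /fhi/andP[].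
have dhN s : s \in `[a, b]%R ->
    has_deriv I (fun s => - h s : R^o) s (- h' s).
  by move=> /dh; exact: has_derivN.
have hf := mean_value_le ab abI dhN dfi.
suff : - h b - - h a <= f b 0 i - f a 0 i by lra.
by apply: hf => s /fhi/andP[].
Qed.

Lemma has_deriv0_cst (f : R -> H) :
  is_interval I -> (forall t, I t -> has_deriv I f t 0) ->
  forall s t, I s -> I t -> f s = f t.
Proof.
move=> Iitv df.
have le_eq s t : s <= t -> I s -> I t -> f t = f s.
  move=> st Is It; have stI : `[s, t] `<=` I.
    by move=> u /=; rewrite in_itv /=; exact: Iitv.
  apply/eqP; rewrite -subr_eq0 -normr_le0 -(subrr (0 : R)).
  apply: (@quat_mean_value f (fun=> 0) (fun=> 0) (fun=> 0) s t st stI).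
  - by move=> u /stI; exact: df.
  - by move=> u _; exact: has_deriv_cst.
  - by move=> u _; rewrite normr0.
by move=> s t Is It; have [/le_eq->|/ltW/le_eq->] := leP s t.
Qed.

End QuatMeanValue.

(** * Primitives on an interval *)

Section Primitive.
Variables (R : realType) (I : set R).
Hypothesis Iitv : is_interval I.
Local Notation mu := (@lebesgue_measure R).

(** Local questions on I reduce to a segment of I that also contains the base
    point t0 and is a neighbourhood of t relative to I.  The endpoints come
    from points of I on either side of t, if there are any. *)
Lemma segment_near (t0 t : R) : I t0 -> I t ->
  exists a b : R, [/\ a <= b, `[a, b] `<=` I, t0 \in `[a, b]%R,
    t \in `[a, b]%R & \forall s \near t, I s -> s \in `[a, b]%R].
Proof.
move=> It0 It.
have [a [Ia at0 a_t an]] : exists a, [/\ I a, a <= t0, a <= t &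
    \forall s \near t, I s -> a <= s].
  have [[u [Iu ut]]|nu] := pselect (exists u, I u /\ u < t).
    exists (Num.min u t0); split; rewrite ?ge_min ?lexx ?orbT ?(ltW ut) //.
      by rewrite /Num.min; case: ifP.
    near=> s => _; rewrite ge_min; apply/orP; left.
    by apply: ltW; near: s; exact: lt_nbhsr.
  exists (Num.min t t0); split; rewrite ?ge_min ?lexx ?orbT //.
    by rewrite /Num.min; case: ifP.
  near=> s => Is; rewrite ge_min leNgt; apply/orP; left.
  by apply/negP => st; apply: nu; exists s.
have [b [Ib bt0 b_t bn]] : exists b, [/\ I b, t0 <= b, t <= b &
    \forall s \near t, I s -> s <= b].
  have [[u [Iu ut]]|nu] := pselect (exists u, I u /\ t < u).
    exists (Num.max u t0); split; rewrite ?le_max ?lexx ?orbT ?(ltW ut) //.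
      by rewrite /Num.max; case: ifP.
    near=> s => _; rewrite le_max; apply/orP; left.
    by apply: ltW; near: s; exact: lt_nbhsl.
  exists (Num.max t t0); split; rewrite ?le_max ?lexx ?orbT //.
    by rewrite /Num.max; case: ifP.
  near=> s => Is; rewrite le_max leNgt; apply/orP; left.
  by apply/negP => st; apply: nu; exists s.
exists a, b; split.
- exact: le_trans at0 bt0.
- by move=> s; rewrite /= in_itv /=; exact: Iitv.
- by rewrite in_itv /= at0.
- by rewrite in_itv /= a_t.
- near=> s => Is; rewrite in_itv /=; apply/andP; split.
    by move: Is; near: s.
  by move: Is; near: s.
Unshelve. all: by end_near. Qed.

(** The retraction of the line onto [a, b].  Composing with it extends a map
    that is continuous on a segment of I to the whole line, where integrals and
    two-sided derivatives are available. *)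
Definition clamp (a b s : R) : R := Num.max a (Num.min b s).

Lemma clamp_itv a b s : a <= b -> clamp a b s \in `[a, b]%R.
Proof.
by move=> ab; rewrite in_itv /= le_max lexx /= ge_max ab ge_min lexx.
Qed.

Lemma clamp_id a b s : s \in `[a, b]%R -> clamp a b s = s.
Proof.
by rewrite in_itv /= => /andP[? ?]; rewrite /clamp (min_idPr _) ?(max_idPr _).
Qed.

Lemma clamp_continuous (f : R -> R^o) a b : a <= b -> `[a, b] `<=` I ->
  cont_on I f -> continuous (f \o clamp a b).
Proof.
move=> ab abI cf s.
have cc : clamp a b u @[u --> s] --> clamp a b s.
  apply: (@continuous_max R R (fun=> a : R^o)
    (fun u => Num.min b u : R^o) s); first exact: cvg_cst.
  apply: (@continuous_min R R (fun=> b : R^o) (fun u => u : R^o) s).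
    exact: cvg_cst.
  exact: cvg_id.
have Ic : I (clamp a b s) by apply/abI/clamp_itv.
apply: cvg_trans (cf _ Ic) => A; rewrite /within /=.
move=> /cc; rewrite /= !near_simpl; apply: filterS => u; apply.
by apply/abI/clamp_itv.
Qed.

(** The primitive is the integral from t0 with its sign, so that its definition
    does not depend on a segment.  Near t it differs by a constant from the
    integral G of a clamped extension of f, started strictly to the left of the
    segment so that G has a two-sided derivative on all of the segment. *)
Lemma primitive_on (f : R -> R^o) (t0 : R) : cont_on I f -> I t0 ->
  exists F : R -> R^o, F t0 = 0 /\ forall t, I t -> has_deriv I F t (f t).
Proof.
move=> cf It0.
pose F t : R^o := if t0 <= t then (\int[mu]_(s in `[t0, t]) f s)%R
                  else - (\int[mu]_(s in `[t, t0]) f s)%R.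
exists F; split.
  by rewrite /F lexx set_itv1 Rintegral_set1.
move=> t It.
have [a [b [ab abI t0ab tab nearab]]] := segment_near It0 It.
pose g : R -> R^o := f \o clamp a b.
have gc : continuous g by exact: clamp_continuous.
have gf s : s \in `[a, b]%R -> g s = f s.
  by move=> /clamp_id sE; rewrite /g /= sE.
have gi c d : mu.-integrable `[c, d] (EFin \o g).
  apply: continuous_compact_integrable; first exact: segment_compact.
  exact: continuous_subspaceT.
pose G s : R^o := (\int[mu]_(u in `[(a - 1)%R, s]) g u)%R.
have int_f c d : a <= c -> c <= d -> d <= b ->
    (\int[mu]_(s in `[c, d]) f s)%R = G d - G c.
  move=> ac cd db.
  have -> : (\int[mu]_(s in `[c, d]) f s)%R = (\int[mu]_(s in `[c, d]) g s)%R.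
    apply: eq_Rintegral => s; rewrite inE /= in_itv /= => /andP[cs sd].
    by rewrite gf // in_itv /= (le_trans ac cs) (le_trans sd db).
  rewrite /G Rintegral_itvB ?bnd_simp //; last by lra.
  rewrite Rintegral_itv_obnd_cbnd //.
  by apply: integrableS (gi c d) => //; exact: subset_itv_oc_cc.
have FG s : s \in `[a, b]%R -> F s = G s - G t0.
  move: t0ab; rewrite !in_itv /= => /andP[a0 b0] /andP[as_ sb].
  rewrite /F; case: leP => ts; first by rewrite int_f.
  by rewrite int_f ?opprB // ltW.
have dG : has_deriv I G t (f t).
  apply: is_derive_has_deriv.
  move: (tab); rewrite in_itv /= => /andP[a_t tb].
  have [||||dG GE] := @continuous_FTC1_closed R g (a - 1) t (b + 1).
  - lra.
  - exact: gi.
  - lra.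
  - exact: gc.
  by split; [exact: dG | rewrite -derive1E GE gf].
have := has_derivD dG (has_deriv_cst I (- G t0) t); rewrite addr0.
apply: has_deriv_near => //; near=> s => Is.
by rewrite FG //; move: Is; near: s.
Unshelve. all: by end_near. Qed.

Lemma quat_primitive_on (f : R -> quat R) (t0 : R) : cont_on I f -> I t0 ->
  exists F : R -> quat R, F t0 = 0 /\ forall t, I t -> has_deriv I F t (f t).
Proof.
move=> cf It0.
have /choice[F FP] : forall i : 'I_4, exists F : R -> R^o, F t0 = 0 /\
    forall t, I t -> has_deriv I F t (f t 0 i).
  move=> i; apply: primitive_on => // t It.
  exact: (quat_coord_cvg _ (cf t It)).
exists (fun t => \row_i F i t); split.
  by apply/rowP => i; rewrite !mxE; have [] := FP i.
move=> t It; apply/has_deriv_coord => i.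
have [_ /(_ t It)] := FP i; apply: has_deriv_eq => // s _.
by rewrite mxE.
Qed.

End Primitive.

(** * Linear differential equations *)

Section GeometricCauchy.
Variables (R : realType) (V : completeNormedModType R) (u : V^nat) (C : R).
Hypothesis uC : forall n, `|u n.+1 - u n| <= C * 2^-1 ^+ n.

Lemma geometric_cauchy_cvgn : cvgn u.
Proof.
have : cvgn (series (telescope u)).
  apply: normed_cvg; apply: (@series_le_cvg _ _ (geometric C 2^-1)).
  - by move=> n; exact: normr_ge0.
  - by move=> n; apply: le_trans (uC n); exact: normr_ge0.
  - by move=> n; exact: uC.
  - by apply: is_cvg_geometric_series; rewrite gtr0_norm; lra.
move=> h; have -> : u = (fun=> u 0%N) + series (telescope u).
  by apply/funext => n; rewrite [LHS](eq_sum_telescope u n).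
by apply: is_cvgD => //; exact: is_cvg_cst.
Qed.

(** The tail of a geometric series of ratio 1/2 is twice its first term. *)
Lemma geometric_cauchy_dist n : `|u n - lim (u @ \oo)| <= 2 * C * 2^-1 ^+ n.
Proof.
have um m : `|u n - u (n + m)%N| <= 2 * C * 2^-1 ^+ n - 2 * C * 2^-1 ^+ (n + m).
  elim: m => [|m ih]; first by rewrite addn0 !subrr normr0.
  rewrite addnS; have := uC (n + m)%N; rewrite exprS distrC => h.
  by have := ler_distD (u (n + m)%N) (u n) (u (n + m).+1); lra.
have C0 : 0 <= C.
  by have := uC 0; rewrite expr0; have := normr_ge0 (u 1%N - u 0); lra.
apply/ler_addgt0Pl => e e0.
have /cvgrPdist_le/(_ _ e0) := geometric_cauchy_cvgn.
move=> [N _ Ne]; have := Ne (n + N)%N (leq_addl _ _); rewrite /= distrC => {}Ne.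
have := ler_distD (u (n + N)%N) (u n) (lim (u @ \oo)); have := um N.
have : 0 <= 2 * C * 2^-1 ^+ (n + N).
  by rewrite !mulr_ge0 // exprn_ge0 // invr_ge0.
lra.
Qed.

End GeometricCauchy.

Lemma geometric_le0 (R : realType) (x C : R) :
  (forall n, x <= C * 2^-1 ^+ n) -> x <= 0.
Proof.
move=> xC.
have h : (geometric C 2^-1 : R^nat) @ \oo --> (0 : R).
  by apply: cvg_geometric; rewrite gtr0_norm; lra.
by apply: (cvgr_to_ge h); near=> n; exact: xC.
Unshelve. all: by end_near.
Qed.

Section Picard.
Variables (R : realType) (I : set R).
Hypothesis Iitv : is_interval I.
Local Notation H := (quat R).

Lemma has_deriv_expo (c k t0 t : R) :
  has_deriv I (fun s => c * expR (k * (s - t0)) : R^o) t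
    (c * k * expR (k * (t - t0)) : R^o).
Proof.
apply: is_derive_has_deriv.
apply: is_derive_eq.
by rewrite /GRing.scale /=; ring.
Qed.

(** The gain of a factor 1/2: 2 K exp (2 K r) is the derivative of
    exp (2 K r), so integrating a bound K c exp (2 K |s - t0|) from t0 leaves
    at most c/2 exp (2 K |t - t0|). *)
Lemma weighted_mean_value (g g' : R -> H) (a b t0 c K : R) :
  0 < K -> 0 <= c -> `[a, b] `<=` I -> t0 \in `[a, b]%R -> g t0 = 0 ->
  (forall s, s \in `[a, b]%R -> has_deriv I g s (g' s)) ->
  (forall s, s \in `[a, b]%R -> `|g' s| <= K * c * expR (2 * K * `|s - t0|)) ->
  forall t, t \in `[a, b]%R -> `|g t| <= c / 2 * expR (2 * K * `|t - t0|).
Proof.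
move=> K0 c0 abI t0ab g0 dg g'le t tab.
have sub u v : u \in `[a, b]%R -> v \in `[a, b]%R ->
    forall s, s \in `[u, v]%R -> s \in `[a, b]%R.
  rewrite !in_itv /= => /andP[au _] /andP[_ vb] s; rewrite !in_itv /=.
  by move=> /andP[us sv]; rewrite (le_trans au us) (le_trans sv vb).
have [tt0|t0t] := leP t0 t.
- have := quat_mean_value tt0 (f := g) (f' := g') (I := I)
    (h := fun s => c / 2 * expR (2 * K * (s - t0)))
    (h' := fun s => c / 2 * (2 * K) * expR (2 * K * (s - t0))).
  rewrite g0 subr0 subrr mulr0 expR0 mulr1 ger0_norm ?subr_ge0 // => h.
  apply: le_trans (h _ _ _ _) _.
  + by move=> s /(sub _ _ t0ab tab) /abI.
  + by move=> s /(sub _ _ t0ab tab) /dg.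
  + by move=> s _; exact: has_deriv_expo.
  + move=> s sI; apply: le_trans (g'le _ (sub _ _ t0ab tab _ sI)) _.
    move: sI; rewrite in_itv /= => /andP[s0 _].
    by rewrite ger0_norm ?subr_ge0 // [c / 2 * _](_ : _ = K * c) //; field.
  + by lra.
- have := quat_mean_value (ltW t0t) (f := g) (f' := g') (I := I)
    (h := fun s => - (c / 2) * expR (- (2 * K) * (s - t0)))
    (h' := fun s => - (c / 2) * - (2 * K) * expR (- (2 * K) * (s - t0))).
  rewrite g0 sub0r normrN subrr mulr0 expR0 mulr1 ltr0_norm ?subr_lt0 // => h.
  apply: le_trans (h _ _ _ _) _.
  + by move=> s /(sub _ _ tab t0ab) /abI.
  + by move=> s /(sub _ _ tab t0ab) /dg.
  + by move=> s _; exact: has_deriv_expo.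
  + move=> s sI; apply: le_trans (g'le _ (sub _ _ tab t0ab _ sI)) _.
    move: sI; rewrite in_itv /= => /andP[_ s0].
    rewrite ler0_norm ?subr_le0 // (_ : - (c / 2) * - (2 * K) = K * c).
      by rewrite mulrN mulNr.
    by field.
  + by rewrite mulrN mulNr mulNr; lra.
Qed.

Lemma cont_on_bounded (A : R -> H) (a b : R) :
  cont_on I A -> a <= b -> `[a, b] `<=` I ->
  exists2 M : R, 0 <= M & forall s, s \in `[a, b]%R -> `|A s| <= M.
Proof.
move=> cA ab abI.
have [|c cab cmax] := @EVT_max R (fun s => `|A s|) a b ab.
  apply: (@cont_on_itv _ I R^o) => // t It.
  by apply: cvg_norm; exact: cA.
by exists `|A c|.
Qed.

Lemma cont_on_quatM (f g : R -> H) :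
  cont_on I f -> cont_on I g -> cont_on I (fun s => f s * g s).
Proof. by move=> cf cg t It; apply: quat_cvgM; [exact: cf | exact: cg]. Qed.

(** Picard iteration for b = 1 + P (A b), where P f is the primitive of f that
    vanishes at t0.  The iterates are defined on all of I and converge
    geometrically on every segment of I, so that no patching is needed.  The
    limit G is continuous, which makes 1 + P (A G) differentiable, and the
    iterates also converge to it; hence it equals G. *)
Theorem linear_ode (A : R -> H) (t0 : R) : cont_on I A -> I t0 ->
  exists b : R -> H, b t0 = 1 /\ forall t, I t -> has_deriv I b t (A t * b t).
Proof.
move=> cA It0.
have /choice[P PP] : forall f : R -> H, exists F : R -> H, cont_on I f ->
    F t0 = 0 /\ forall t, I t -> has_deriv I F t (f t).
  move=> f; have [cf|ncf] := pselect (cont_on I f); last by exists f.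
  by have [F FP] := quat_primitive_on Iitv cf It0; exists F.
pose S f t := 1 + P (fun s => A s * f s) t.
have dS f : cont_on I f -> forall t, I t -> has_deriv I (S f) t (A t * f t).
  move=> cf t It; have [_ dP] := PP _ (cont_on_quatM cA cf).
  by have := has_derivD (has_deriv_cst I (1 : H) t) (dP t It); rewrite add0r.
have S0 f : cont_on I f -> S f t0 = 1.
  by move=> cf; have [P0 _] := PP _ (cont_on_quatM cA cf); rewrite /S P0 addr0.
have cS f : cont_on I f -> cont_on I (S f).
  by move=> cf t It; exact: has_deriv_cont (dS f cf t It).
pose F n := iter n S (fun=> 1 : H).
have cF n : cont_on I (F n).
  elim: n => [|n]; last exact: cS.
  by move=> t It; exact: cvg_cst.
have F0 n : F n t0 = 1 by case: n => [//|n]; exact: S0.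
have seg a b : a <= b -> `[a, b] `<=` I -> t0 \in `[a, b]%R ->
    exists K C, [/\ 0 < K, 0 <= C,
      forall t, t \in `[a, b]%R -> expR (2 * K * `|t - t0|) <= C,
      forall s q, s \in `[a, b]%R -> `|A s * q| <= K * `|q| &
      forall n t, t \in `[a, b]%R -> `|F n.+1 t - F n t| <= C * 2^-1 ^+ n].
  move=> ab abI t0ab; have [M M0 AM] := cont_on_bounded cA ab abI.
  (* The summand 1 makes K positive when A vanishes on the segment. *)
  pose K := 4 * M + 1; pose C := expR (2 * K * (b - a)).
  have K0 : 0 < K by rewrite /K; lra.
  have KA s q : s \in `[a, b]%R -> `|A s * q| <= K * `|q|.
    move=> sab; apply: le_trans (quat_normM _ _) _; apply: ler_wpM2r => //.
    by have := AM s sab; rewrite /K; lra.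
  have eC t : t \in `[a, b]%R -> expR (2 * K * `|t - t0|) <= C.
    move: t0ab; rewrite !in_itv /= => /andP[? ?] /andP[? ?].
    rewrite ler_expR ler_wpM2l //; first by lra.
    by rewrite ler_norml; apply/andP; split; lra.
  exists K, C; split=> //; first exact: expR_ge0.
  (* All iterates agree at t0, so each step integrates A (F n.+1 - F n). *)
  have Fe n t : t \in `[a, b]%R ->
      `|F n.+1 t - F n t| <= 2^-1 ^+ n.+1 * expR (2 * K * `|t - t0|).
    elim: n t => [|n ih] t tab.
      rewrite expr1 -[2^-1]div1r.
      have Ig s : s \in `[a, b]%R ->
          has_deriv I (fun s => F 1 s - F 0 s) s (A s * F 0 s - 0).
        move=> /abI Is; apply: has_derivB; first exact: (dS _ (cF 0%N)).
        exact: has_deriv_cst.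
      apply: (weighted_mean_value K0 ler01 abI t0ab _ Ig _ tab).
        by rewrite !F0 subrr.
      move=> s sab; rewrite subr0; apply: le_trans (KA _ _ sab) _.
      rewrite mulr1 ler_pM2l // /F /=.
      apply: le_trans (quat_norm1 R) _.
      by rewrite -[leLHS]expR0 ler_expR mulr_ge0 // mulr_ge0 // ltW.
    have Ig s : s \in `[a, b]%R ->
        has_deriv I (fun s => F n.+2 s - F n.+1 s) s
          (A s * F n.+1 s - A s * F n s).
      move=> /abI Is; apply: has_derivB; first exact: (dS _ (cF n.+1)).
      exact: (dS _ (cF n)).
    have c0 : 0 <= 2^-1 ^+ n.+1 :> R by rewrite exprn_ge0.
    rewrite [_ ^+ n.+2]exprSr.
    apply: (weighted_mean_value K0 c0 abI t0ab _ Ig _ tab).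
      by rewrite !F0 subrr.
    move=> s sab; rewrite -mulrBr; apply: le_trans (KA _ _ sab) _.
    by rewrite -mulrA ler_pM2l // ih.
  move=> n t tab; apply: le_trans (Fe n t tab) _.
  rewrite mulrC ler_pM ?expR_ge0 ?exprn_ge0 //; first exact: eC.
  by rewrite exprS ler_piMl ?exprn_ge0 //; lra.
pose G t := lim (F n t @[n --> \oo]).
have FG a b : a <= b -> `[a, b] `<=` I -> t0 \in `[a, b]%R ->
    exists2 C, 0 <= C & forall n t, t \in `[a, b]%R ->
      `|F n t - G t| <= C * 2^-1 ^+ n.
  move=> ab abI t0ab; have [K [C [_ C0 _ _ FC]]] := seg a b ab abI t0ab.
  exists (2 * C); first by rewrite mulr_ge0.
  by move=> n t tab; apply: geometric_cauchy_dist => m; exact: FC.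
have cG : cont_on I G.
  move=> t It; have [a [b [ab abI t0ab tab nab]]] := segment_near Iitv It0 It.
  have [C C0 FC] := FG a b ab abI t0ab.
  apply/cvgrPdist_le => e e0.
  (* A single iterate n, uniformly close to G on the segment, is enough: it is
     continuous at t. *)
  have [n ne] : exists n, C * 2^-1 ^+ n <= e / 3.
    apply: contrapT => /forallNP h; suff : e / 3 <= 0 by lra.
    apply: (@geometric_le0 _ _ C) => n; apply: ltW; rewrite ltNge.
    exact/negP.
  have /cvgrPdist_le/(_ (e / 3)) := cF n t It.
  have e3 : 0 < e / 3 by lra.
  move=> /(_ e3); rewrite near_withinE => Fn.
  rewrite near_withinE; near=> s => Is.
  have sab : s \in `[a, b]%R by move: Is; near: s.
  have h1 := FC n t tab; have h2 := FC n s sab.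
  have h3 : `|F n t - F n s| <= e / 3 by move: Is; near: s.
  have := ler_distD (F n t) (G t) (G s).
  have := ler_distD (F n s) (F n t) (G s).
  by rewrite [`|G t - F n t|]distrC; lra.
exists (S G); split; first exact: S0.
move=> t It; have := dS G cG t It.
(* S G has derivative A G; it remains to see that S G is G. *)
suff -> : G t = S G t by [].
have [a [b [ab abI t0ab tab nab]]] := segment_near Iitv It0 It.
have [C C0 FC] := FG a b ab abI t0ab.
have [K [C' [K0 C'0 eC KA _]]] := seg a b ab abI t0ab.
apply/eqP; rewrite -subr_eq0 -normr_le0.
apply: (@geometric_le0 _ _ (C + C * C')) => n.
have Ig s : s \in `[a, b]%R ->
    has_deriv I (fun s => F n.+1 s - S G s) s (A s * F n s - A s * G s).
  move=> /abI Is; apply: has_derivB; last exact: dS.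
  exact: (dS _ (cF n)).
have c0 : 0 <= C * 2^-1 ^+ n by rewrite mulr_ge0 // exprn_ge0.
have h2 := weighted_mean_value K0 c0 abI t0ab _ Ig _ tab.
have {}h2 : `|F n.+1 t - S G t| <= C * 2^-1 ^+ n / 2 * expR (2 * K * `|t - t0|).
  apply: h2; first by rewrite F0 S0 // subrr.
  move=> s sab; rewrite -mulrBr; apply: le_trans (KA _ _ sab) _.
  rewrite -[K * _]mulr1 ler_pM ?mulr_ge0 // ?(ltW K0) //.
    by rewrite ler_pM2l // FC.
  by rewrite -[leLHS]expR0 ler_expR mulr_ge0 // mulr_ge0 // ltW.
have h3 : C * 2^-1 ^+ n / 2 * expR (2 * K * `|t - t0|) <= C * C' * 2^-1 ^+ n.
  rewrite -[C * C' * _]mulrAC ler_pM ?expR_ge0 ?divr_ge0 // ?eC //; lra.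
have h1 := FC n.+1 t tab; rewrite exprS in h1.
have := ler_distD (F n.+1 t) (G t) (S G t).
rewrite [`|G t - F _ t|]distrC mulrDl; lra.
Unshelve. all: by end_near. Qed.

End Picard.

(** * Conjugation and inversion of quaternions *)

Section QuatConj.
Variable R : realType.
Local Notation H := (quat R).
Implicit Types p q : H.

Definition qconj q : H := mkquat (qre q) (- qi q) (- qj q) (- qk q).

Definition qnorm2 q : R := qre (q * qconj q).

Definition qinv q : H := (qnorm2 q)^-1 *: qconj q.

Lemma qmulE p q : p * q = mulquat p q. Proof. by []. Qed.

Lemma qoneE : 1 = onequat R :> H. Proof. by []. Qed.

Lemma qconj_linear : linear qconj.
Proof.
by move=> c p q; apply: quatP; rewrite !(mkquatE, quatDE, quatZE); split; ring.
Qed.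

Lemma qconjM p q : qconj (p * q) = qconj q * qconj p.
Proof. by apply: quatP; rewrite !qmulE !mkquatE; split; ring. Qed.

Lemma qconj1 : qconj 1 = 1.
Proof. by apply: quatP; rewrite !qoneE !mkquatE !oppr0. Qed.

Lemma qre_linear : linear (@qre R : H -> R^o).
Proof. by move=> c p q; rewrite quatDE quatZE. Qed.

Lemma qconj_continuous : continuous qconj.
Proof.
move=> q; apply: (quat_cvg (nbhs_filter q)) => i; move: i.
have cc i : (c : H) 0 i @[c --> q] --> (q 0 i : R^o).
  exact: (@coord_continuous R 1 4 0 i q).
apply: (quat_coord
  (P := fun c => c (qconj s) @[s --> q] --> (c (qconj q) : R^o))).
all: rewrite mkquatE; under eq_fun => s do rewrite mkquatE.
- exact: cc.
- exact: (cvgN (cc (inord 1))).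
- exact: (cvgN (cc (inord 2))).
- exact: (cvgN (cc (inord 3))).
Qed.

Lemma qre_continuous : continuous (@qre R : H -> R^o).
Proof. exact: coord_continuous. Qed.

Lemma qnorm2E q : qnorm2 q = qre q ^+ 2 + qi q ^+ 2 + qj q ^+ 2 + qk q ^+ 2.
Proof. by rewrite /qnorm2 qmulE !mkquatE; ring. Qed.

Lemma qnorm2_neq0 q : q != 0 -> qnorm2 q != 0.
Proof.
apply: contra_neq; rewrite qnorm2E => /eqP.
rewrite !paddr_eq0 ?addr_ge0 ?sqr_ge0 // !sqrf_eq0 => /andP[/andP[/andP[]]].
move=> /eqP q0 /eqP q1 /eqP q2 /eqP q3; apply: quatP.
by rewrite !quat0E.
Qed.

Lemma mulquatV q : q != 0 -> q * qinv q = 1.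
Proof.
move=> /qnorm2_neq0 q0; rewrite /qinv -scalerAr.
have -> : q * qconj q = qnorm2 q *: 1.
  apply: quatP; rewrite qnorm2E !qmulE !qoneE !(mkquatE, quatZE).
  by split; ring.
by rewrite scalerA mulVf // scale1r.
Qed.

Lemma mulVquat q : q != 0 -> qinv q * q = 1.
Proof.
move=> /qnorm2_neq0 q0; rewrite /qinv -scalerAl.
have -> : qconj q * q = qnorm2 q *: 1.
  apply: quatP; rewrite qnorm2E !qmulE !qoneE !(mkquatE, quatZE).
  by split; ring.
by rewrite scalerA mulVf // scale1r.
Qed.

End QuatConj.

(** * Nowhere vanishing solutions *)

Section InvertibleSolution.
Variables (R : realType) (I : set R).
Hypothesis Iitv : is_interval I.
Local Notation H := (quat R).

(** A solution is invertible because the equation c' = - c A has a solution c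
    with c b = 1.  Quaternion conjugation reverses products and so turns this
    equation into one with the coefficient on the left. *)
Lemma linear_ode_neq0 (A : R -> H) (t0 : R) : cont_on I A -> I t0 ->
  exists b : R -> H, forall t, I t ->
    has_deriv I b t (A t * b t) /\ b t != 0.
Proof.
move=> cA It0.
have [b [b0 db]] := linear_ode Iitv cA It0.
have cA' : cont_on I (fun t => - qconj (A t)).
  move=> t It; apply: cvgN; apply: continuous_cvg; last exact: cA.
  exact: qconj_continuous.
have [d [d0 dd]] := linear_ode Iitv cA' It0.
exists b => t It; split; first exact: db.
have cb s : I s -> has_deriv I (fun s => qconj (d s) * b s) s 0.
  move=> Is; have := has_deriv_quatM (has_deriv_linear (@qconj_linear R)
    (@qconj_continuous R) (dd s Is)) (db s Is).
  have -> : qconj (- qconj (A s) * d s) = - (qconj (d s) * A s).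
    rewrite qconjM -mulrN; congr (_ * _).
    apply: quatP; rewrite -scaleN1r -[- A s]scaleN1r !(quatZE, mkquatE).
    by split; ring.
  by rewrite mulNr mulrA addNr.
have cb1 : qconj (d t) * b t = 1.
  by rewrite (has_deriv0_cst Iitv cb It It0) b0 d0 mulr1 qconj1.
apply/eqP => bt; move: cb1; rewrite bt mulr0 => /esym/eqP.
by rewrite oner_eq0.
Qed.

End InvertibleSolution.

(** * Smooth maps on an interval *)

Section Smoothness.
Variables (R : realType) (I : set R).

(** The derivatives are existentially quantified rather than given by
    [derive_on], so that only their values on I matter and the closure rules
    below are plain inductions. *)
Fixpoint Cn (V : normedModType R) (n : nat) (f : R -> V) : Prop :=
  if n is n'.+1 then
    exists f' : R -> V, (forall t, I t -> has_deriv I f t (f' t)) /\ Cn n' f'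
  else True.

Lemma Cn_eq (V : normedModType R) n (f g : R -> V) :
  (forall t, I t -> f t = g t) -> Cn n f -> Cn n g.
Proof.
case: n => // n fg [f' [df Cf]]; exists f'; split=> // t It.
exact: has_deriv_eq (df t It).
Qed.

Lemma CnW (V : normedModType R) n (f : R -> V) : Cn n.+1 f -> Cn n f.
Proof.
elim: n f => // n ih f [f' [df Cf]]; exists f'; split=> //; exact: ih.
Qed.

Lemma CnD (V : normedModType R) n (f g : R -> V) :
  Cn n f -> Cn n g -> Cn n (fun t => f t + g t).
Proof.
elim: n f g => // n ih f g [f' [df Cf]] [g' [dg Cg]].
exists (fun t => f' t + g' t); split; last exact: ih.
by move=> t It; apply: has_derivD; [exact: df | exact: dg].
Qed.

Lemma Cn_cst (V : normedModType R) n (c : V) : Cn n (fun=> c).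
Proof.
elim: n c => // n ih c; exists (fun=> 0); split=> // t It.
exact: has_deriv_cst.
Qed.

Lemma Cn_linear (V W : normedModType R) (L : V -> W) n (f : R -> V) :
  linear L -> continuous L -> Cn n f -> Cn n (L \o f).
Proof.
move=> Ll Lc; elim: n f => // n ih f [f' [df Cf]].
exists (L \o f'); split; last exact: ih.
by move=> t It; apply: has_deriv_linear => //; exact: df.
Qed.

(** Only the Leibniz rule is used: both terms of the derivative of B(f, g) are
    again of the form B(., .), one order lower. *)
Lemma Cn_Leibniz (U V W : normedModType R) (B : U -> V -> W) :
  (forall f g t a b, has_deriv I f t a -> has_deriv I g t b ->
    has_deriv I (fun s => B (f s) (g s)) t (B a (g t) + B (f t) b)) ->
  forall n f g, Cn n f -> Cn n g -> Cn n (fun t => B (f t) (g t)).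
Proof.
move=> dB; elim=> // n ih f g Cf Cg.
have [f' [df Cf']] := Cf; have [g' [dg Cg']] := Cg.
exists (fun t => B (f' t) (g t) + B (f t) (g' t)); split.
  by move=> t It; apply: dB; [exact: df | exact: dg].
by apply: CnD; apply: ih => //; exact: CnW.
Qed.

Lemma CnM n (f g : R -> quat R) : Cn n f -> Cn n g -> Cn n (fun t => f t * g t).
Proof.
apply: (Cn_Leibniz (B := fun u v : quat R => u * v)) => *.
exact: has_deriv_quatM.
Qed.

Lemma CnZ n (V : normedModType R) (f : R -> R^o) (g : R -> V) :
  Cn n f -> Cn n g -> Cn n (fun t => f t *: g t).
Proof.
apply: (Cn_Leibniz (B := fun (u : R^o) (v : V) => u *: v)) => *.
exact: has_derivZ.
Qed.

Lemma CnB (V : normedModType R) n (f g : R -> V) :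
  Cn n f -> Cn n g -> Cn n (fun t => f t - g t).
Proof.
move=> Cf Cg; apply: (Cn_eq (f := fun t => f t + (-1 : R^o) *: g t)).
  by move=> t _; rewrite scaleN1r.
by apply: CnD => //; apply: CnZ => //; exact: Cn_cst.
Qed.

(** The derivative - f' f^-1 f^-1 only involves f^-1 to the previous order. *)
Lemma CnV n (f : R -> R^o) : (forall t, I t -> f t != 0) ->
  Cn n f -> Cn n (fun t => (f t)^-1 : R^o).
Proof.
move=> f0; elim: n => // n ih Cf; have [f' [df Cf']] := Cf.
exists (fun t => - f' t * (f t)^-1 * (f t)^-1); split.
  by move=> t It; apply: has_derivV; [exact: f0 | exact: df].
have CV := ih (CnW Cf).
apply: (Cn_eq (f := fun t => (0 - f' t) *: ((f t)^-1 *: (f t)^-1 : R^o))).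
  by move=> t _; rewrite sub0r /GRing.scale /= mulrA.
apply: CnZ; last exact: CnZ.
by apply: CnB => //; exact: Cn_cst.
Qed.

End Smoothness.

Section SmoothOn.
Variables (R : realType) (I : set R) (V : normedModType R).
Hypotheses (Iitv : is_interval I) (I0 : I° !=set0).

Lemma smooth_onP (f : R -> V) : smooth_on I f <-> forall n, Cn I n f.
Proof.
split.
- move=> sf n; elim: n f sf => // n ih f sf; exists (derive_on I f); split.
    by move=> t It; apply: derivable_on_has_deriv => //; exact: (sf 0%N).
  by apply: ih => k; rewrite -iterSr; exact: sf.
- move=> + n; elim: n f => [|n ih] f Cf.
    by have [f' [df _]] := Cf 1%N; exact: has_deriv_derivable_on df.
  rewrite iterSr; apply: ih => k; have [f' [df Cf']] := Cf k.+1.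
  apply: Cn_eq Cf' => t It; apply/esym.
  by apply: has_deriv_derive_on => //; exact: df.
Qed.

End SmoothOn.

(** * Darboux transforms and parallel sections *)

Section DualCurve.
Variables (R : realType) (I : set R).
Hypotheses (Iitv : is_interval I) (I0 : I° !=set0).
Local Notation H := (quat R).

(** The dual curve is only assumed differentiable; its derivative is smooth
    because it is m^-1 (x')^-1, and the inverse of a quaternion is its
    conjugate divided by its squared norm. *)
Lemma Cn_derive_dual (m : R -> R) (x xd : R -> H) n :
  polarisation I m -> regular_curve I x -> dual_curve I m x xd ->
  Cn I n (derive_on I xd).
Proof.
move=> [sm m0] [sx x0] [_ xxd].
have Cx : Cn I n (derive_on I x).
  apply: (smooth_onP Iitv I0 _).1 => k; rewrite -iterSr; exact: sx.
have Cc : Cn I n (@qconj R \o derive_on I x).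
  by apply: Cn_linear Cx; [exact: qconj_linear | exact: qconj_continuous].
have CN : Cn I n (fun t => qnorm2 (derive_on I x t) : R^o).
  apply: (Cn_linear (L := @qre R : H -> R^o)) (CnM Cx Cc).
    exact: qre_linear.
  exact: qre_continuous.
have Cm : Cn I n (m : R -> R^o) by apply: (smooth_onP Iitv I0 _).1.
have N0 t : I t -> qnorm2 (derive_on I x t) != 0.
  by move=> /x0; exact: qnorm2_neq0.
apply: Cn_eq (CnZ (CnV m0 Cm) (CnZ (CnV N0 CN) Cc)) => t It /=.
rewrite -[_ *: qconj _]/(qinv (derive_on I x t)).
rewrite -[RHS]mul1r -(mulVquat (x0 t It)) -mulrA (xxd t It).
by rewrite -scalerAr mulr1.
Qed.

End DualCurve.

Section Lines.
Variable R : realType.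
Local Notation H := (quat R).

Lemma mul_scalar_col (v : 'cV[H]_2) (h : H) i : (v *m h%:M) i 0 = v i 0 * h.
Proof. by rewrite !mxE big_ord1 !mxE eqxx mulr1n. Qed.

(** Two generators of the same right line differ by a right factor, here
    necessarily the second component of v. *)
Lemma line_affine_ptP (v : 'cV[H]_2) (y : H) : v 1 0 != 0 ->
  line v = line (affine_pt y) <-> v 0 0 = y * v 1 0.
Proof.
move=> v0; split=> [lv|v0E].
- have : line v v by exists 1 => //; rewrite mulmx1.
  rewrite lv => -[h _ vE].
  by rewrite -vE !mul_scalar_col !mxE /= mul1r.
- have vE i : v i 0 = affine_pt y i 0 * v 1 0.
    rewrite mxE; case: i => -[|[|//]] i /=; rewrite ?mul1r -?v0E;
      by congr (v _ _); exact/val_inj.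
  rewrite predeqE => w; split=> -[h _ <-].
    exists (v 1 0 * h) => //; apply/matrixP => i j.
    by rewrite ord1 !mul_scalar_col mulrA -vE.
  exists (qinv (v 1 0) * h) => //; apply/matrixP => i j.
  by rewrite ord1 !mul_scalar_col vE -mulrA [v 1 0 * _]mulrA mulquatV ?mul1r.
Qed.

End Lines.

Section Parallel.
Variables (R : realType) (I : set R).
Local Notation H := (quat R).

(** On a section (y b, b) both rows of eta have the common factor
    (x^d)' (y - x) b, multiplied by x on the left in the first row. *)
Lemma connectionE (x xd : R -> H) (mu t : R) (phi : R -> 'cV[H]_2) (y : H) :
  phi t 0 0 = y * phi t 1 0 ->
  let E := mu *: (derive_on I xd t * (y - x t) * phi t 1 0) in
  connection I x xd mu phi t = 0 <->
  derive_on I (fun s => phi s 0 0) t = - (x t * E) /\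
  derive_on I (fun s => phi s 1 0) t = - E.
Proof.
move=> phi0 E; set D := derive_on I xd t.
have e1 : 1 = lift ord0 ord0 :> 'I_2 by exact/val_inj.
have c1 : connection I x xd mu phi t 1 0 =
    derive_on I (fun s => phi s 1 0) t + E.
  rewrite !mxE !big_ord_recl big_ord0 !mxE /= addr0 -e1 phi0; congr (_ + _).
  rewrite -scalerAl mul1r /E -/D; congr (_ *: _).
  by rewrite mulrBr mulrBl mulrA mulNr.
have c0 : connection I x xd mu phi t 0 0 =
    derive_on I (fun s => phi s 0 0) t + x t * E.
  rewrite !mxE !big_ord_recl big_ord0 !mxE /= addr0 -e1 phi0; congr (_ + _).
  rewrite -scalerAl mul1r /E -/D -scalerAr; congr (_ *: _).
  by rewrite mulrBr mulrBl mulrBr mulNr !mulrA.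
split=> [c|[d0 d1]].
  rewrite c !mxE in c0 c1; split; apply/eqP; rewrite -addr_eq0.
    by rewrite -c0.
  by rewrite -c1.
apply/matrixP => i j; rewrite ord1 [RHS]mxE.
have [->|->] : i = 0 \/ i = 1.
  by case: i => -[|[|//]] i; [left | right]; exact/val_inj.
  by rewrite c0 d0 addNr.
by rewrite c1 d1 addNr.
Qed.

End Parallel.

(** The common core of both implications: with D the derivative of the dual
    curve and E = mu D (z - y) b, the Riccati value of z' and b' = - E give
    (z b)' = z' b + z b' = (z - y) E - z E = - y E. *)
Lemma riccati_identity (R : realType) (mu : R) (y z D b : quat R) :
  (mu *: ((z - y) * D * (z - y))) * b + z * - (mu *: (D * (z - y) * b)) =
  - (y * (mu *: (D * (z - y) * b))).
Proof.
set E := mu *: (D * (z - y) * b).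
have -> : (mu *: ((z - y) * D * (z - y))) * b = (z - y) * E.
  by rewrite /E -scalerAr -scalerAl !mulrA.
by rewrite mulrBl mulrN addrAC subrr add0r.
Qed.

Theorem theorem2p5 (R : realType) (I : set R) (m : R -> R)
    (x xd : R -> quat R) (mu : R) (xhat : R -> quat R) :
  is_interval I -> I° !=set0 ->
  polarisation I m ->
  regular_curve I x ->
  dual_curve I m x xd ->
  smooth_on I xhat ->
  darboux_transform I x xd mu xhat <->
  exists phi : R -> 'cV[quat R]_2,
    [/\ smooth_section I phi,
        forall t, I t -> phi t 1 0 != 0,
        parallel I x xd mu phi &
        forall t, I t -> line (phi t) = line (affine_pt (xhat t))].
Proof.
move=> Iitv I0 pol reg dual sxhat.
have [sx _] := reg.
pose T t := xhat t - x t; pose D t := derive_on I xd t.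
have dxhat t : I t -> has_deriv I xhat t (derive_on I xhat t).
  by move=> It; exact: (derivable_on_has_deriv (sxhat 0%N) It).
split=> [[_ ricc]|[phi [sphi phi1 par lphi]]]; last first.
  split; first exact: (sxhat 0%N).
  move=> t It; have phiE s : I s -> phi s 0 0 = xhat s * phi s 1 0.
    by move=> Is; apply/line_affine_ptP; [exact: phi1 | exact: lphi].
  have [d0 d1] := (connectionE I x xd mu (phiE t It)).1 (par t It).
  have dphi i : has_deriv I (fun s => phi s i 0) t
      (derive_on I (fun s => phi s i 0) t).
    exact: (derivable_on_has_deriv (sphi i 0%N) It).
  have := has_deriv_quatM (dxhat t It) (dphi 1).
  move=> /(has_deriv_eq It (fun s Is => esym (phiE s Is))).
  move=> /(has_deriv_derive_on Iitv I0 It); rewrite d0 d1 => dE.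
  rewrite -[LHS]mulr1 -[RHS]mulr1 -(mulquatV (phi1 t It)) !mulrA; congr (_ * _).
  (* After adding xhat b' on the right, both sides are (xhat b)'. *)
  apply: (addIr (xhat t * - (mu *: (D t * T t * phi t 1 0)))).
  by rewrite riccati_identity dE.
have [t0 It0] := I0; have {}It0 := nbhs_singleton It0.
(* The coefficient of the linear equation satisfied by the second component. *)
pose A t := - mu *: (D t * T t).
have CA n : Cn I n A.
  apply: CnZ; first exact: Cn_cst.
  apply: CnM; first exact: Cn_derive_dual dual.
  by apply: CnB; apply: (smooth_onP Iitv I0 _).1.
have cA : cont_on I A.
  by move=> t It; have [A' [dA _]] := CA 1%N; exact: has_deriv_cont (dA t It).
have [b bP] := linear_ode_neq0 Iitv cA It0.
have db t It := (bP t It).1; have b0 t It := (bP t It).2.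
(* b' = A b is as differentiable as b, and b is one order more. *)
have Cb n : Cn I n b.
  elim: n => // n ih; exists (fun t => A t * b t); split=> //; exact: CnM.
have AbE t : A t * b t = - (mu *: (D t * T t * b t)).
  by rewrite /A -scalerAl scaleNr.
have Cxb n : Cn I n (fun t => xhat t * b t).
  by apply: CnM => //; apply: (smooth_onP Iitv I0 _).1.
pose phi t : 'cV[quat R]_2 := \col_i if i == 0 then xhat t * b t else b t.
have phi0 : (fun t => phi t 0 0) = (fun t => xhat t * b t).
  by apply/funext => t; rewrite mxE.
have phi1 : (fun t => phi t 1 0) = b by apply/funext => t; rewrite mxE.
have phi0t t : phi t 0 0 = xhat t * b t by rewrite mxE.
have phi1t t : phi t 1 0 = b t by rewrite mxE.
exists phi; split.
- move=> i; have [->|->] : i = 0 \/ i = 1.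
    by case: i => -[|[|//]] i; [left | right]; exact/val_inj.
  + by rewrite phi0; apply/(smooth_onP Iitv I0).
  + by rewrite phi1; apply/(smooth_onP Iitv I0).
- by move=> t It; rewrite phi1t; exact: b0.
- move=> t It; apply/(@connectionE _ _ _ _ _ _ _ (xhat t)).
    by rewrite phi0t phi1t.
  rewrite phi0 phi1 phi1t -/(T t) -/(D t) -AbE; split.
    have := has_deriv_quatM (dxhat t It) (db t It).
    move=> /(has_deriv_derive_on Iitv I0 It) ->.
    by rewrite ricc // AbE riccati_identity.
  by rewrite (has_deriv_derive_on Iitv I0 It (db t It)).
- by move=> t It; apply/line_affine_ptP; rewrite ?phi0t ?phi1t ?b0.
Qed.
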